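(* Let $\mathfrak g$ be a Lie algebra in $\mathrm{Ver}_4^+$ with underlying object $2P$ such that the ordinary Lie algebra $L=\ker d\subset\mathfrak g$ is not abelian. Then $\mathfrak g$ has (up to isomorphism) a basis $x,y,x',y'$, with $x'=dx$, $y'=dy$ and $[x',y']=x'$, in which the brackets are given by one of the following two cases, with parameters $\mu,\nu\in k$: Case 1: $[x,x]=0$, $[y,y]=y'$, $[x,y]=\mu x'$, $[x',x]=x'$, $[x',y]=x+y'$, $[y',x]=x+y'$, $[y',y]=\nu x'$; Case 2: $[x,x]=0$, $[y,y]=y'$, $[x,y]=\mu x'$, $[x',x]=0$, $[x',y]=x$, $[y',x]=x$, $[y',y]=\nu x'$.
   Context: Let $k$ be an algebraically closed field of characteristic $2$. $\mathrm{Ver}_4^+$ is the symmetric tensor category whose objects are finite-dimensional $k$-vector spaces $V$ with a linear endomorphism $d$, $d^2=0$ (write $x'=dx$), morphisms are linear maps commuting with $d$, $d$ acts on tensor products by $d\otimes1+1\otimes d$, and the braiding is $c(v\otimes w)=w\otimes v+w'\otimes v'$. $P$ is the two-dimensional object $k[d]/d^2$, and $2P=P\oplus P$. A Lie algebra in $\mathrm{Ver}_4^+$ is an object with a bilinear bracket $[\cdot,\cdot]$ satisfying $d[x,y]=[x',y]+[x,y']$; $[x,y]+[y,x]+[y',x']=0$; $[[x,y],z]+[[z,x],y]+[[y,z],x]+[[x',y],z']+[[z',x],y']+[[y',z],x']=0$; and $[x,x]=0$ whenever $x'=0$. (In particular $[x,y]=[y,x]$ if $y\in\ker d$, and $\ker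 d$ is an ordinary Lie algebra; remaining brackets are determined by these axioms.) Isomorphisms are linear bijections commuting with $d$ and preserving the bracket. *)

(* Defs.v *)
From HB Require Import structures.
From mathcomp Require Import all_boot all_order all_algebra.

Set Implicit Arguments.
Unset Strict Implicit.
Unset Printing Implicit Defensive.

Import GRing.Theory.
Local Open Scope ring_scope.

(* The category Ver_4^+ makes sense as such only for k algebraically closed of
   characteristic 2; that hypothesis is carried by the statements, not by the
   definitions below. *)
Record ver4p (k : fieldType) := Ver4p {
  ver4p_space :> vectType k;
  dif : 'End(ver4p_space);
  difK : forall v, dif (dif v) = 0
}.
Arguments dif {k v} : rename.

Definition ver4p_iso (k : fieldType) (V W : ver4p k) : Prop :=
  exists2 f : {linear V -> W}, bijective f & {morph f : v / dif v}.

Section RegularObject.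
Variable k : fieldType.

Local Notation A := {poly %/ 'X^2 : {poly k}}.

(* The class of d in k[d]/d^2 is the library's 'qX. *)
Definition mul_qX (v : A) : A := 'qX * v.

Fact mul_qX_is_linear : linear mul_qX.
Proof. by move=> a u v; rewrite /mul_qX mulrDr scalerAr. Qed.

HB.instance Definition _ :=
  GRing.isLinear.Build k A A *:%R mul_qX mul_qX_is_linear.

Definition regular_dif : 'End(A) := linfun mul_qX.

Fact regular_difK v : regular_dif (regular_dif v) = 0.
Proof.
rewrite !lfunE /= /mul_qX mulrA.
suff -> : 'qX * 'qX = 0 :> A by rewrite mul0r.
have monX : mk_monic ('X^2 : {poly k}) = 'X^2.
  by rewrite /mk_monic size_polyXn monicXn.
rewrite -in_qpolyM -expr2; apply/val_eqP => /=.
by rewrite monX Pdiv.RingMonic.rmodpp ?monicXn.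
Qed.

Definition regular_obj := Ver4p regular_difK.

End RegularObject.

Section DirectSum.
Variables (k : fieldType) (V W : ver4p k).

Definition dsum_fun (u : V * W) : V * W := (dif u.1, dif u.2).

Fact dsum_fun_is_linear : linear dsum_fun.
Proof. by move=> a [u1 u2] [v1 v2]; rewrite /dsum_fun /= !linearP. Qed.

HB.instance Definition _ :=
  GRing.isLinear.Build k (V * W)%type (V * W)%type *:%R dsum_fun
    dsum_fun_is_linear.

Definition dsum_dif : 'End((V * W)%type) := linfun dsum_fun.

Fact dsum_difK u : dsum_dif (dsum_dif u) = 0.
Proof. by rewrite !lfunE /= /dsum_fun /= !difK. Qed.

Definition dsum := Ver4p dsum_difK.

End DirectSum.

Record lie_ver4p (k : fieldType) := LieVer4p {
  lie_obj :> ver4p k;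
  bracket : {bilinear lie_obj -> lie_obj -> lie_obj};
  dif_bracket : forall x y,
    dif (bracket x y) = bracket (dif x) y + bracket x (dif y);
  bracket_antisym : forall x y,
    bracket x y + bracket y x + bracket (dif y) (dif x) = 0;
  bracket_jacobi : forall x y z,
    bracket (bracket x y) z + bracket (bracket z x) y + bracket (bracket y z) x
    + bracket (bracket (dif x) y) (dif z)
    + bracket (bracket (dif z) x) (dif y)
    + bracket (bracket (dif y) z) (dif x) = 0;
  bracket_alt : forall x, dif x = 0 -> bracket x x = 0
}.

Notation "[br x , y ]" := (bracket _ x y)
  (at level 0, x, y at level 99, format "[br  x ,  y ]") : ring_scope.

Definition ker_abelian (k : fieldType) (g : lie_ver4p k) : Prop :=
  forall u v : g, u \in lker dif -> v \in lker dif -> [br u, v] = 0.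

(* Main.v *)
Require Import Defs.
From mathcomp Require Import all_boot all_order all_algebra.
Import GRing.Theory.
Local Open Scope ring_scope.

(** The second family of brackets already contains the first one up to a change
    of basis: in Case 1 the vector x + y' has the same image under d as x, and
    replacing x by it gives Case 2 with mu + nu in place of mu.  So it is enough
    to find one good basis, and the proof always ends in Case 2.

    Write L = ker d.  In a sum of copies of P one has ker d = im d, so here L
    is two-dimensional and every element of L lifts along d.  As L is not
    abelian, it has a basis a, b with [a,b] = a ([ker_eigenpair]).  The point is
    the choice of the lifts: take any y with dy = b, and then x := [a,y], which
    satisfies dx = [a,b] = a.  With this x no coefficient has to be normalised
    afterwards.

    The derivation rule for [a,b] = a applied to y gives [b,x] = x.  The
    brackets [x,x], [y,y], [a,x], [b,y] and [x,y] are all killed by d, hence lie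
    in L, and the Jacobi identity controls how each of them commutes with a or
    b: L acts on g by derivations ([bracket_ker_mor]), [[z,z],l] = [[z',l],z']
    for l in L ([bracket_square]), and [[z,z],z] = [[z',z],z']
    ([bracket_cube]).  This is enough to find them, because the centre of L is
    trivial ([ker_center]), the centraliser of a in L is the line through a
    ([ker_centralizer_a]), and b acts on L with eigenvalue 1 on that line only.
    The brackets that are found as arbitrary multiples of a are [x,y] and
    [b,y], with coefficients mu and nu. *)

(** * The underlying object *)

Section Objects.
Context {k : fieldType}.

(** As d^2 = 0, this says that the homology ker d / im d vanishes; among the
    objects of the category it singles out the sums of copies of P. *)
Definition acyclic (V : ver4p k) :=
  forall v : V, dif v = 0 -> exists w : V, v = dif w.

Let qX : {poly %/ 'X^2 : {poly k}} := 'qX.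

Lemma val_qX : val qX = 'X.
Proof. by apply: qpolyXE; rewrite ?size_polyXn ?monicXn. Qed.

Lemma regular_polyE (p : regular_obj k) :
  p = p`_0 *: (1 : {poly %/ 'X^2}) + p`_1 *: 'qX :> {poly %/ 'X^2}.
Proof.
apply: val_inj; rewrite /= -[X in _ + _ *: X]/(val qX) val_qX.
have sp : (size (val p) <= 2)%N.
  by rewrite -ltnS (leq_trans (size_mk_monic p)) // mk_monic_Xn size_polyXn.
apply/polyP => -[|[|i]]; rewrite coefD !coefZ coef1 coefX /= ?mulr0 ?mulr1.
- by rewrite addr0.
- by rewrite add0r.
by rewrite addr0 nth_default // (leq_trans sp).
Qed.

(** Multiplication by d sends c + e d to c d, so the kernel consists of the
    multiples of d, which are the values at constants. *)
Lemma regular_acyclic : acyclic (regular_obj k).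
Proof.
move=> p; rewrite lfunE /= /mul_qX.
set c := p`_0; set e := p`_1; have -> : p = c *: 1 + e *: 'qX by apply: regular_polyE.
have qX2 : 'qX * 'qX = 0 :> {poly %/ 'X^2 : {poly k}}.
  by have := regular_difK (1 : {poly %/ 'X^2 : {poly k}});
     rewrite !lfunE /= /mul_qX mulr1.
rewrite mulrDr -!scalerAr qX2 scaler0 addr0 mulr1 => /eqP.
rewrite scaler_eq0 => /orP[/eqP-> | /eqP qX0].
  exists (e *: 1 : {poly %/ 'X^2}).
  by rewrite lfunE /= /mul_qX scale0r add0r -scalerAr mulr1.
by have := val_qX; rewrite /qX qX0 /= => /eqP; rewrite eq_sym polyX_eq0.
Qed.

Lemma dim_regular : \dim {:regular_obj k} = 2%N.
Proof. by rewrite dim_polyn mk_monic_Xn size_polyXn. Qed.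

Lemma dsum_acyclic (V W : ver4p k) :
  acyclic V -> acyclic W -> acyclic (dsum V W).
Proof.
move=> exV exW [v w]; rewrite lfunE /= /dsum_fun /= => -[/exV[v1 ->] /exW[w1 ->]].
by exists (v1, w1); rewrite lfunE.
Qed.

Lemma dim_dsum (V W : ver4p k) :
  \dim {:dsum V W} = (\dim {:V} + \dim {:W})%N.
Proof. by rewrite !dimvf. Qed.

Lemma iso_acyclic {V W : ver4p k} : ver4p_iso V W -> acyclic W -> acyclic V.
Proof.
move=> [f [h fK hK] fd] exW v dv0.
have [|w fvE] := exW (f v); first by rewrite -fd dv0 linear0.
by exists (h w); rewrite -[v]fK -[RHS]fK fd hK fvE.
Qed.

Lemma iso_dim {V W : ver4p k} : ver4p_iso V W -> \dim {:V} = \dim {:W}.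
Proof.
move=> [f [h fK hK] _].
have kf : lker (linfun f) == 0%VS.
  by apply/lker0P => u v; rewrite !lfunE => /(can_inj fK).
have <- : (linfun f @: fullv)%VS = fullv.
  apply/vspaceP => w; rewrite memvf; apply/memv_imgP.
  by exists (h w); rewrite ?memvf // lfunE /= hK.
by rewrite limg_dim_eq // (eqP kf) capv0.
Qed.

(** Rank-nullity, with the kernel and the image being the same space. *)
Lemma acyclic_dim_ker (V : ver4p k) :
  acyclic V -> (\dim (lker (dif (v := V)))).*2 = \dim {:V}.
Proof.
move=> exV; rewrite -(limg_ker_dim dif fullv) capfv -addnn; congr (_ + \dim _)%N.
apply/vspaceP => v; rewrite memv_ker; apply/eqP/memv_imgP.
  by move=> /exV[w ->]; exists w; rewrite ?memvf.
by move=> [w _ ->]; rewrite difK.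
Qed.

Lemma span2P (V : vectType k) (a b v : V) :
  reflect (exists c e, v = c *: a + e *: b) (v \in <<[:: a; b]>>%VS).
Proof.
rewrite span_cons span_seq1; apply: (iffP memv_addP).
  by move=> [_ /vlineP[c ->] [_ /vlineP[e ->] ->]]; exists c, e.
by move=> [c [e ->]]; exists (c *: a); rewrite ?memvZ ?memv_line //;
   exists (e *: b); rewrite ?memvZ ?memv_line.
Qed.

(** Subtracting from v the combination of x and y with the same image under d
    leaves an element of ker d, so x, y and a basis of ker d span V. *)
Lemma acyclic_basis {V : ver4p k} (x y : V) :
    acyclic V -> \dim {:V} = 4%N ->
    basis_of (lker dif) [:: dif x; dif y] ->
  basis_of fullv [:: x; y; dif x; dif y].
Proof.
move=> exV dimV /span_basis spanK.
rewrite basisEdim dimV andbT; apply/subvP => v _.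
have /span2P[c [e dvE]] : dif v \in <<[:: dif x; dif y]>>%VS.
  by rewrite spanK memv_ker difK.
rewrite -[[:: x, y & _]]/([:: x; y] ++ [:: dif x; dif y]) span_cat spanK.
rewrite -[v](subrKC (c *: x + e *: y)) memv_add //.
  by apply/span2P; exists c, e.
by rewrite memv_ker linearB linearD !linearZ /= dvE subrr.
Qed.

End Objects.

(** * Brackets with arguments in the kernel of the differential *)

Section Brackets.
Context {k : fieldType} (char2 : 2%N \in [pchar k]) {g : lie_ver4p k}.
Implicit Types (a b l v x y z : g).

Lemma addvv {V : lmodType k} (v : V) : v + v = 0.
Proof. by rewrite -[v]scale1r -scalerDl (addrr_pchar2 char2) scale0r. Qed.

Lemma oppv {V : lmodType k} (v : V) : - v = v.
Proof. by apply/eqP; rewrite eq_sym -addr_eq0 addvv. Qed.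

Lemma addv_eq0 {V : lmodType k} (u v : V) : u + v = 0 -> u = v.
Proof. by move=> /eqP; rewrite addr_eq0 oppv => /eqP. Qed.

Lemma bracket_kerC l v : dif l = 0 -> [br v, l] = [br l, v].
Proof.
move=> dl; apply: addv_eq0.
by have := bracket_antisym v l; rewrite dl linear0l addr0.
Qed.

(** When two of the arguments lie in ker d, every correction term of the Jacobi
    identity contains the differential of one of them, so only the ordinary
    identity is left. *)
Lemma bracket_ker_mor a b v : dif a = 0 -> dif b = 0 ->
  [br [br a, b], v] = [br a, [br b, v]] + [br b, [br a, v]].
Proof.
move=> da db; have := bracket_jacobi a b v.
rewrite da db !(linear0l, linear0r) !addr0 -addrA => /addv_eq0 ->.
by rewrite addrC (bracket_kerC a) // (bracket_kerC a v) // (bracket_kerC b).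
Qed.

(** This is the Jacobi identity for l, z, z, where [[l,z],z] and [[z,l],z]
    cancel.  It controls [z,z], which the alternating axiom leaves free when
    z is not in ker d. *)
Lemma bracket_square z l : dif l = 0 ->
  [br [br z, z], l] = [br [br dif z, l], dif z].
Proof.
move=> dl; have := bracket_jacobi l z z.
rewrite dl !(linear0l, linear0r) !addr0 (bracket_kerC l z) //.
rewrite (addvv (bracket g _ _)) add0r.
exact: addv_eq0.
Qed.

(** In the Jacobi identity for z, z, z each of the two terms occurs three times,
    and so once modulo 2. *)
Lemma bracket_cube z : [br [br z, z], z] = [br [br dif z, z], dif z].
Proof.
have := bracket_jacobi z z z; rewrite (addvv (bracket g _ _)) add0r -addrA.
by rewrite (addvv (bracket g _ _)) addr0 => /addv_eq0.
Qed.

(** The commutator w = [u,v] of a basis u, v of ker d is an eigenvector of both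
    u and v, with its own coordinates as eigenvalues; one of them is nonzero,
    and u or v can be scaled to make it 1. *)
Lemma ker_eigenpair :
    \dim (lker (dif (v := g))) = 2%N -> ~ ker_abelian g ->
  exists2 a : g, dif a = 0 /\ a != 0 & exists2 b : g, dif b = 0 & [br a, b] = a.
Proof.
move=> dimL nabL; have := vbasisP (lker (dif (v := g))).
case: (vbasis _) => s /= /eqP; rewrite dimL.
case: s => [|u [|v [|? ?]]] // _ basuv.
have spanL : <<[:: u; v]>>%VS = lker dif by apply: span_basis.
have inL l : dif l = 0 -> exists c e, l = c *: u + e *: v.
  by move=> dl; apply/span2P; rewrite spanL memv_ker dl.
have [du dv] : dif u = 0 /\ dif v = 0.
  by split; apply/eqP; rewrite -memv_ker (basis_mem basuv) // !inE eqxx ?orbT.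
have [uv0 | w_neq0] := eqVneq [br u, v] 0.
  case: nabL => l1 l2; rewrite !memv_ker.
  move=> /eqP/inL[c1 [e1 ->]] /eqP/inL[c2 [e2 ->]].
  rewrite !(linearDl, linearDr, linearZl_LR, linearZr_LR) /=.
  rewrite !bracket_alt // (bracket_kerC u) // uv0.
  by rewrite !(scaler0, addr0).
set w := [br u, v] in w_neq0.
have dw : dif w = 0 by rewrite dif_bracket du dv linear0l linear0r addr0.
have [c [e wE]] := inL w dw.
have wv : [br w, v] = c *: w.
  by rewrite {1}wE linearDl !linearZl_LR /= bracket_alt // scaler0 addr0.
have wu : [br w, u] = e *: w.
  rewrite {1}wE linearDl !linearZl_LR /= bracket_alt // scaler0 add0r.
  by rewrite (bracket_kerC u).
exists w => //; have [c0 | c_neq0] := eqVneq c 0.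
  have e_neq0 : e != 0.
    by apply: contraNneq w_neq0 => e0; rewrite wE c0 e0 !scale0r addr0.
  exists (e^-1 *: u); first by rewrite linearZ /= du scaler0.
  by rewrite linearZr_LR /= wu scalerA mulVf // scale1r.
exists (c^-1 *: v); first by rewrite linearZ /= dv scaler0.
by rewrite linearZr_LR /= wv scalerA mulVf // scale1r.
Qed.

(** * The brackets of the adapted basis *)

Section NormalForm.
Context {a b y : g}.
Hypotheses (da : dif a = 0) (db : dif b = 0) (a_neq0 : a != 0).
Hypothesis ab : [br a, b] = a.
Hypothesis dimL : \dim (lker (dif (v := g))) = 2%N.

Lemma eigenpair_basis : basis_of (lker dif) [:: a; b].
Proof.
have free_ab : free [:: a; b].
  rewrite free_cons span_seq1 seq1_free; apply/andP; split; last first.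
    by apply: contraNneq a_neq0 => b0; rewrite -ab b0 linear0r.
  apply: contra a_neq0 => /vlineP[c aE].
  by rewrite -ab aE linearZl_LR /= bracket_alt // scaler0.
rewrite basisEfree free_ab dimL andbT; apply/subvP => v /span2P[c [e ->]].
by rewrite memv_ker linearD !linearZ /= da db !scaler0 addr0.
Qed.

Lemma kerE l : dif l = 0 -> exists c e, l = c *: a + e *: b.
Proof.
by move=> dl; apply/span2P; rewrite (span_basis eigenpair_basis) memv_ker dl.
Qed.

Lemma br_comb_a c e : [br c *: a + e *: b, a] = e *: a.
Proof.
rewrite linearDl !linearZl_LR /= bracket_alt // (bracket_kerC a) // ab.
by rewrite scaler0 add0r.
Qed.

Lemma br_comb_b c e : [br c *: a + e *: b, b] = c *: a.
Proof.
by rewrite linearDl !linearZl_LR /= bracket_alt // ab scaler0 addr0.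
Qed.

Lemma ker_centralizer_a l : dif l = 0 -> [br l, a] = 0 -> exists c, l = c *: a.
Proof.
move=> /kerE[c [e ->]]; rewrite br_comb_a => /eqP.
rewrite scaler_eq0 (negPf a_neq0) orbF => /eqP->.
by exists c; rewrite scale0r addr0.
Qed.

Lemma ker_center l : dif l = 0 -> [br l, a] = 0 -> [br l, b] = 0 -> l = 0.
Proof.
move=> dl /ker_centralizer_a[] // c ->; rewrite linearZl_LR /= ab => ->.
by [].
Qed.

Hypothesis dy : dif y = b.
(* Among the lifts of a, the right one is dictated by y: Case 2 requires
   [a,y] = x. *)
Let x := [br a, y].

Lemma dif_normal_x : dif x = a.
Proof. by rewrite dif_bracket da dy linear0l add0r ab. Qed.
Let dx := dif_normal_x.

Lemma dif_bracket_self z : dif [br z, z] = 0.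
Proof. by rewrite dif_bracket (bracket_kerC (dif z)) ?difK // addvv. Qed.

Lemma br_xx : [br x, x] = 0.
Proof.
apply: ker_center; rewrite ?dif_bracket_self // bracket_square // dx.
  by rewrite bracket_alt // linear0l.
by rewrite ab bracket_alt.
Qed.

(** The commutators of [y,y] with a and b are those of b. *)
Lemma br_yy : [br y, y] = b.
Proof.
apply: addv_eq0; apply: ker_center.
- by rewrite linearD /= dif_bracket_self db addr0.
- by rewrite linearDl /= bracket_square // dy (bracket_kerC a b) // ab ab addvv.
- by rewrite linearDl /= bracket_square // dy (bracket_alt db) linear0l addr0.
Qed.

(** The element t = [b,y] of ker d satisfies t = [t,b] by [bracket_cube] for y,
    since [y,y] = b; and b acts on ker d with eigenvalue 1 exactly on the line
    through a. *)
Lemma br_by : exists nu, [br b, y] = nu *: a.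
Proof.
have dt : dif [br b, y] = 0 by rewrite dif_bracket db dy linear0l bracket_alt // addr0.
have [c [e tE]] := kerE _ dt; exists c.
by have := bracket_cube y; rewrite br_yy dy {2}tE br_comb_b.
Qed.

(** The derivation rule for a = [a,b], applied to y, gives
    x = [a,[b,y]] + [b,x], where [b,y] is a multiple of a. *)
Lemma br_bx : [br b, x] = x.
Proof.
have [nu byE] := br_by.
have := bracket_ker_mor a b y da db; rewrite ab -/x byE linearZr_LR /=.
by rewrite bracket_alt // scaler0 add0r.
Qed.

(** The element [a,x] of ker d commutes with a by [bracket_cube] for x, and with
    b because the derivation rule for a = [a,b], applied to x, reads
    [a,x] = [a,x] + [b,[a,x]]. *)
Lemma br_ax : [br a, x] = 0.
Proof.
have ds : dif [br a, x] = 0 by rewrite dif_bracket da dx linear0l bracket_alt // addr0.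
apply: ker_center => //.
  by have := bracket_cube x; rewrite br_xx linear0l dx.
have := bracket_ker_mor a b x da db; rewrite ab br_bx (bracket_kerC b) //.
by move=> /eqP; rewrite addrC -subr_eq subrr eq_sym => /eqP.
Qed.

(** Since [a,y] and [b,x] are both x, the bracket [x,y] lies in ker d.  It
    commutes with a by the Jacobi identity for a, x, y: the correction term
    [[b,a],a] vanishes, and so do [[a,x],y] and [[y,a],x] = [x,x]. *)
Lemma br_xy : exists mu, [br x, y] = mu *: a.
Proof.
have dxy : dif [br x, y] = 0.
  by rewrite dif_bracket dx dy -/x (bracket_kerC b) // br_bx addvv.
apply: ker_centralizer_a => //.
have := bracket_jacobi a x y.
rewrite br_ax linear0l add0r (bracket_kerC a y) // -/x br_xx add0r.
rewrite da dx dy !(linear0l, linear0r) (bracket_kerC a b) // ab bracket_alt //.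
by rewrite !addr0.
Qed.

End NormalForm.
End Brackets.

Theorem proposition4p24 (k : closedFieldType) (k_char2 : 2%N \in [pchar k])
    (g : lie_ver4p k)
    (g_2P : ver4p_iso g (dsum (regular_obj k) (regular_obj k)))
    (L_nonabelian : ~ ker_abelian g) :
  exists (x y : g) (mu nu : k),
    let x' := dif x in
    let y' := dif y in
    [/\ basis_of fullv [:: x; y; x'; y'],
        [br x', y'] = x' &
        [/\ [br x, x] = 0, [br y, y] = y', [br x, y] = mu *: x',
            [br x', x] = x' &
            [/\ [br x', y] = x + y', [br y', x] = x + y' &
                [br y', y] = nu *: x']]
        \/
        [/\ [br x, x] = 0, [br y, y] = y', [br x, y] = mu *: x',
            [br x', x] = 0 &
            [/\ [br x', y] = x, [br y', x] = x & [br y', y] = nu *: x']]].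
Proof.
have acyc : acyclic g.
  by apply: iso_acyclic g_2P _; apply: dsum_acyclic; apply: regular_acyclic.
have dimg : \dim {:g} = 4%N by rewrite (iso_dim g_2P) dim_dsum !dim_regular.
have dimL : \dim (lker (dif (v := g))) = 2%N.
  by apply: double_inj; rewrite acyclic_dim_ker.
have [a [da a_neq0] [b db ab]] := ker_eigenpair k_char2 dimL L_nonabelian.
have [y /esym dy] := acyc b db.
have dx : dif [br a, y] = a by apply: dif_normal_x ab dy.
have [mu xyE] := br_xy k_char2 da db a_neq0 ab dimL dy.
have [nu byE] := br_by k_char2 da db a_neq0 ab dimL dy.
exists [br a, y], y, mu, nu; rewrite /= dx dy; split => //.
  rewrite -{2}dx -{1}dy; apply: acyclic_basis => //.
  by rewrite dx dy; apply: eigenpair_basis.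
right; split => //.
- exact: br_xx ab dimL dy.
- exact: br_yy ab dimL dy.
- exact: br_ax ab dimL dy.
by split => //; apply: br_bx ab dimL dy.
Qed.
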